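(* Let $(X,d)$ be a cone metric space, and let $c\in X$ and $r\in E$ with $0\ll r$ be such that for any $x\in X$, either $d(x,c)\le r$ or $r\ll d(x,c)$. If $c$ is a cluster point of a sequence $\{x_n\}$ in $X$, then $LIM^{r}x_n\subset\overline{B_r(c)}$.
   Context: Let $E$ be a real Banach space. A subset $P\subset E$ is a cone if (i) $P$ is closed, nonempty and $P\neq\{0\}$; (ii) $a,b\in\mathbb{R}$, $a,b\ge 0$, $x,y\in P$ implies $ax+by\in P$; (iii) $x\in P$ and $-x\in P$ implies $x=0$. Write $x\le y$ if $y-x\in P$, $x<y$ if $x\le y$ and $x\ne y$, and $x\ll y$ if $y-x\in \mathrm{int}\,P$ (the interior of $P$). A cone metric space $(X,d)$ (associated with $E$ and $P$) is a nonempty set $X$ with a map $d:X\times X\to E$ such that for all $x,y,z\in X$: $0\le d(x,y)$, and $d(x,y)=0$ iff $x=y$; $d(x,y)=d(y,x)$; $d(x,y)\le d(x,z)+d(z,y)$. For $r\in E$ with $0\ll r$ or $r=0$, a sequence $\{x_n\}$ in $X$ is $r$-convergent to $x\in X$ if for every $\epsilon\in E$ with $0\ll\epsilon$ there is $k\in\mathbb{N}$ such that $d(x_n,x)\ll r+\epsilon$ for all $n\ge k$. The $r$-limit set is $LIM^{r}x_n=\{x\in X: \{x_n\}\text{ is } r\text{-convergent to } x\}$. A point $c\in X$ is a cluster point of $\{x_n\}$ if for every $\epsilon\in E$ with $0\ll\epsilon$ and every $k\in\mathbb{N}$ there is $k_1\in\mathbb{N}$ with $k_1>k$ and $d(x_{k_1},c)\ll\epsilon$.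 For $0\ll r$ and $y\in X$, $\overline{B_r(y)}=\{x\in X: d(x,y)\le r\}$. *)

(* Defs.v *)
From HB Require Import structures.
From mathcomp Require Import all_boot all_order all_algebra.
From mathcomp Require Import all_classical all_reals all_analysis.
Set Implicit Arguments.
Unset Strict Implicit.
Unset Printing Implicit Defensive.
Import Order.TTheory GRing.Theory Num.Theory.
Import numFieldNormedType.Exports.
Local Open Scope classical_set_scope.
Local Open Scope ring_scope.

Section Cone.
Context {R : realType} {E : completeNormedModType R}.

Record is_cone (P : set E) : Prop := IsCone {
  cone_closed : closed P;
  cone_nonempty : P !=set0;
  cone_neq0 : P <> [set 0];
  cone_comb : forall (a b : R) (x y : E),
    0 <= a -> 0 <= b -> P x -> P y -> P (a *: x + b *: y);
  cone_salient : forall x : E, P x -> P (- x) -> x = 0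
}.

Definition cone_le (P : set E) (x y : E) : Prop := P (y - x).

Definition cone_ll (P : set E) (x y : E) : Prop := interior P (y - x).

Record is_cone_metric (P : set E) (X : Type) (d : X -> X -> E) : Prop :=
  IsConeMetric {
  cone_metric_nonempty : [set: X] !=set0;
  cone_metric_ge0 : forall x y : X, cone_le P 0 (d x y);
  cone_metric_eq0 : forall x y : X, d x y = 0 <-> x = y;
  cone_metric_sym : forall x y : X, d x y = d y x;
  cone_metric_triangle : forall x y z : X, cone_le P (d x y) (d x z + d z y)
}.

(* Only meant for r with cone_ll P 0 r or r = 0. *)
Definition r_convergent (P : set E) (X : Type) (d : X -> X -> E)
    (r : E) (u : nat -> X) (x : X) : Prop :=
  forall eps : E, cone_ll P 0 eps ->
    exists k : nat, forall n : nat, (k <= n)%N ->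
      cone_ll P (d (u n) x) (r + eps).

Definition r_limit_set (P : set E) (X : Type) (d : X -> X -> E)
    (r : E) (u : nat -> X) : set X :=
  [set x | r_convergent P d r u x].

Definition cone_cluster_point (P : set E) (X : Type) (d : X -> X -> E)
    (u : nat -> X) (c : X) : Prop :=
  forall eps : E, cone_ll P 0 eps ->
    forall k : nat, exists k1 : nat,
      (k < k1)%N /\ cone_ll P (d (u k1) c) eps.

Definition cone_closed_ball (P : set E) (X : Type) (d : X -> X -> E)
    (y : X) (r : E) : set X :=
  [set x | cone_le P (d x y) r].

End Cone.

(* Main.v *)
(* By the triangle inequality through a late term of the sequence close to c,
   d(x, c) <= r + eps + eps for every eps >> 0; taking eps = t r with t -> 0+
   and using that P is closed gives d(x, c) <= r. *)
Require Import Defs.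
From HB Require Import structures.
From mathcomp Require Import all_boot all_order all_algebra.
From mathcomp Require Import all_classical all_reals all_analysis.
Import Order.TTheory GRing.Theory Num.Theory.
Import numFieldNormedType.Exports.
Local Open Scope classical_set_scope.
Local Open Scope ring_scope.

Lemma cone_add {R : realType} {E : completeNormedModType R} {P : set E}
    (hP : is_cone P) {x y : E} : P x -> P y -> P (x + y).
Proof.
by move=> Px Py; have := cone_comb hP ler01 ler01 Px Py; rewrite !scale1r.
Qed.

Lemma cone_scale {R : realType} {E : completeNormedModType R} {P : set E}
    (hP : is_cone P) {t : R} {x : E} : 0 <= t -> P x -> P (t *: x).
Proof.
move=> t0 Px; have := cone_comb hP t0 (lexx 0) Px Px.
by rewrite scale0r addr0.
Qed.

(** Multiplication by [t^-1] is continuous and sends [t *: x] to [x], so it maps a whole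
    neighbourhood of [t *: x] into [P]; scaling back by [t] keeps those points in [P]. *)
Lemma cone_ll0_scale {R : realType} {E : completeNormedModType R} {P : set E}
    (hP : is_cone P) {t : R} {x : E} :
  0 < t -> cone_ll P 0 x -> cone_ll P 0 (t *: x).
Proof.
move=> t0; rewrite /cone_ll !subr0 => Px.
have scaleV_cont : t^-1 *: y @[y --> t *: x] --> x.
  have := @scaler_continuous R E t^-1 (t *: x).
  by rewrite /continuous_at scalerA mulVf ?gt_eqF// scale1r.
have : nbhs (t *: x) [set y | P (t^-1 *: y)] := scaleV_cont _ Px.
apply: filterS => y /= Py.
have := cone_scale hP (ltW t0) Py.
by rewrite scalerA mulfV ?gt_eqF// scale1r.
Qed.

(** The points [x + t *: v] tend to [x] as [t] tends to 0 from the right. This lets a cone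
    inequality be proved up to an error [t *: v]. *)
Lemma closed_directional_limit {R : realType} {E : normedModType R} {P : set E}
    (x v : E) :
  closed P -> (forall t : R, 0 < t -> P (x + t *: v)) -> P x.
Proof.
move=> clP Pxv.
have cvg_x : (x + t *: v) @[t --> (0 : R)^'+] --> x.
  rewrite -[X in _ --> X]addr0 -(scale0r v).
  apply: cvgD; first exact: cvg_cst.
  by apply: cvgZr_tmp; exact/cvg_at_right_filter/cvg_id.
apply: (closed_cvg _ clP _ _ cvg_x).
by near=> t; apply: Pxv; near: t; exact: nbhs_right_gt.
Unshelve. all: by end_near.
Qed.

Theorem theorem3p6 (R : realType) (E : completeNormedModType R) (P : set E)
    (hP : is_cone P) (X : Type) (d : X -> X -> E) (hd : is_cone_metric P d)
    (c : X) (r : E) (hr : cone_ll P 0 r)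
    (hcr : forall x : X, cone_le P (d x c) r \/ cone_ll P r (d x c))
    (u : nat -> X) (hc : cone_cluster_point P d u c) :
  r_limit_set P d r u `<=` cone_closed_ball P d c r.
Proof.
move=> x xlim; rewrite /cone_closed_ball /cone_le /=.
(* One [t *: r] pays for the r-convergence to [x], the other for the closeness to [c]. *)
apply: (closed_directional_limit _ (r + r) (cone_closed hP)) => t t0.
have eps0 := cone_ll0_scale hP t0 hr.
have [k ux] := xlim _ eps0.
(* The cluster property is applied beyond the threshold [k], so that both estimates hold at the same
   index [n]. *)
have [n [kn /interior_subset uc]] := hc _ eps0 k.
have /interior_subset {}ux := ux n (ltnW kn).
have := cone_metric_triangle hd x c (u n).
rewrite (cone_metric_sym hd x (u n)) => tri.
(* In the sum of the three cone elements the distances from [u n] to [x] and [c] cancel, leaving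
   [r - d x c + t *: (r + r)]. *)
have := cone_add hP (cone_add hP ux uc) tri.
rewrite [X in X + _]addrACA -opprD subrKA.
by rewrite -(addrA r) addrAC -scalerDr.
Qed.
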